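(* Let $\hat\rho_{\rm loc}$ be any density matrix on $\mathcal H_{\rm loc}$, with spectral decomposition $\hat\rho_{\rm loc}=\sum_{k=1}^{d}\lambda_k|\psi_k\rangle\langle\psi_k|$ ($\{|\psi_k\rangle\}$ orthonormal), rank $r$, $\lambda_k\neq0$ for $k\le r$ and $\lambda_k=0$ for $k>r$. Let ${\rm Im}(\hat\rho_{\rm loc})={\rm span}\{|\psi_1\rangle,\dots,|\psi_r\rangle\}$, so ${\rm Im}(\hat\rho_{\rm loc}^{\otimes n})={\rm Im}(\hat\rho_{\rm loc})^{\otimes n}$, and let $\hat\Pi=\big(\sum_{k=1}^r|\psi_k\rangle\langle\psi_k|\big)^{\otimes n}$ be the orthogonal projection onto ${\rm Im}(\hat\rho_{\rm loc}^{\otimes n})$. Then $\mathcal L(\hat\rho_{\rm loc}^{\otimes n})=0$ if and only if the following four conditions hold simultaneously: (i) for all $i\in\Lambda$ and all $\alpha\in\Gamma_i$, $\hat L_i^{(\alpha)}\,{\rm Im}(\hat\rho_{\rm loc})\subset{\rm Im}(\hat\rho_{\rm loc})$; (ii) $\hat H_{\rm eff}\,{\rm Im}(\hat\rho_{\rm loc}^{\otimes n})\subset {\rm Im}(\hat\rho_{\rm loc}^{\otimes n})$, where $\hat H_{\rm eff}=\hat H-\frac{i}{2}\sum_{i\in\Lambda}\sum_{\alpha\in\Gamma_i}\hat L_i^{(\alpha)\dagger}\hat L_i^{(\alpha)}$; (iii) for all $i\in\Lambda$, $\mathcal P\mathcal L_i(\hat\rho_{\rm loc})=0$, where $\mathcal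 P\mathcal L_i(\bullet)=-i\big[\mathcal T'_i(\hat\Pi\hat H\hat\Pi),\bullet\big]+\sum_{\alpha\in\Gamma_i}\mathcal D_{\hat\Pi\hat L_i^{(\alpha)}\hat\Pi}(\bullet)$; (iv) for all $(i,j)\in\Lambda_2$, $\big[\mathcal T'_{ij}(\hat\Pi\hat H\hat\Pi),(\hat\rho_{\rm loc})_i\otimes(\hat\rho_{\rm loc})_j\big]=0$. Here $\hat\Pi\hat H\hat\Pi$ is regarded as an operator on ${\rm Im}(\hat\rho_{\rm loc})^{\otimes n}$, and $\mathcal T'_{ij},\mathcal T'_i$ are the maps $\mathcal T_{ij},\mathcal T_i$ defined in the context but computed on the space ${\rm Im}(\hat\rho_{\rm loc})^{\otimes n}$ (partial traces over ${\rm Im}(\hat\rho_{\rm loc})$ factors) with $d$ replaced by $r$.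
   Context: Setting: a lattice of $n$ sites labelled by $\Lambda=\{1,\dots,n\}$, with $\Lambda_2=\{(i,j):1\le i<j\le n\}$. Each site carries a copy of a finite-dimensional Hilbert space $\mathcal H_{\rm loc}$ of dimension $d$; the total space is $\mathcal H=\mathcal H_{\rm loc}^{\otimes n}$. For an operator $X$ on $\mathcal H_{\rm loc}$, $X_i$ (or $(X)_i$) denotes $X$ acting on site $i$. The dynamics is the GKSL equation $\frac{d\hat\rho}{dt}=\mathcal L(\hat\rho)=-i[\hat H,\hat\rho]+\sum_k\mathcal D_{\hat L_k}(\hat\rho)$ with $\mathcal D_{\hat L}(\rho)=\hat L\rho\hat L^\dagger-\frac12\{\hat L^\dagger\hat L,\rho\}$. Every Lindblad operator acts on a single site; those acting on site $i$ are denoted $\hat L_i^{(\alpha)}$, $\alpha\in\Gamma_i$. The Hamiltonian $\hat H$ is Hermitian and a sum of terms each acting on at most two sites. ${\rm Tr}_{\overline{ij}}$ (resp. ${\rm Tr}_{\overline i}$) denotes the partial trace over all sites other than $i,j$ (resp. other than $i$). Define $\mathcal T_{ij}(\hat H)=\frac{{\rm Tr}_{\overline{ij}}[\hat H]}{d^{n-2}}-\frac{{\rm Tr}_{\overline i}[\hat H]}{d^{n-1}}-\frac{{\rm Tr}_{\overline j}[\hat H]}{d^{n-1}}+\frac{{\rm Tr}[\hat H]}{d^n}$ and $\mathcal T_i(\hat H)=\frac{{\rm Tr}_{\overline i}[\hat H]}{d^{n-1}}-\frac{{\rm Tr}[\hat H]}{d^n}$ (each regarded as an operator on $\mathcal H$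 acting nontrivially on the indicated sites). *)

(* Defs.v *)
From HB Require Import structures.
From mathcomp Require Import all_boot all_order all_algebra.
Set Implicit Arguments. Unset Strict Implicit. Unset Printing Implicit Defensive.
Import Order.TTheory GRing.Theory Num.Theory.
Local Open Scope ring_scope.

Section QDefs.
Variable C : numClosedFieldType.

Definition adjmx (p q : nat) (A : 'M[C]_(p, q)) : 'M[C]_(q, p) :=
  (map_mx Num.conj A)^T.

Definition comm (p : nat) (A B : 'M[C]_p) : 'M[C]_p := A *m B - B *m A.
Definition diss (p : nat) (Lo X : 'M[C]_p) : 'M[C]_p :=
  Lo *m X *m adjmx Lo
  - 2^-1 *: (adjmx Lo *m Lo *m X + X *m (adjmx Lo *m Lo)).

(* Image (column space) of A : 'M_(p,q) is encoded, MathComp-style, as the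
   row space of A^T; "X maps Im(A) into Im(A)" is then (A^T X^T <= A^T)%MS. *)
Definition maps_image_into (p q : nat) (X : 'M[C]_p) (A : 'M[C]_(p, q)) : bool :=
  (A^T *m X^T <= A^T)%MS.

Definition density (d : nat) (rho : 'M[C]_d) : Prop :=
  [/\ adjmx rho = rho, \tr rho = 1 &
      forall v : 'cV[C]_d, 0 <= (adjmx v *m rho *m v) 0 0].

Variables n d : nat.

(* basis configurations of H = (C^d)^{(x) n} *)
Definition cfg := {ffun 'I_n -> 'I_d}.
Definition dimH := #|{: cfg}|.
Definition op := 'M[C]_dimH.
Definition ent (X : op) (s t : cfg) : C := X (enum_rank s) (enum_rank t).
Definition mkop (f : cfg -> cfg -> C) : op :=
  \matrix_(a, b) f (enum_val a) (enum_val b).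

Definition embloc (f : 'I_n -> 'M[C]_d) : op :=
  mkop (fun s t => \prod_k f k (s k) (t k)).
Definition emb1 (i : 'I_n) (X : 'M[C]_d) : op :=
  embloc (fun k => if k == i then X else 1%:M).

Definition glue (S : {set 'I_n}) (t p : cfg) : cfg :=
  [ffun k => if k \in S then t k else p k].

(* red S Q X = Tr_{complement of S}[X] (x) Q^{(x) complement of S} *)
Definition red (S : {set 'I_n}) (Q : 'M[C]_d) (X : op) : op :=
  mkop (fun s t =>
    (\prod_(k | k \notin S) Q (s k) (t k)) *
    \sum_(p : cfg | [forall k in S, p k == s k]) ent X p (glue S t p)).

(* normalized partial trace computed on Im(rho)^{(x) n}: identity of the
   local subspace is the projector P, and d is replaced by r *)
Definition avgp (r : nat) (P : 'M[C]_d) (S : {set 'I_n}) (X : op) : op :=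
  ((r%:R : C) ^- (n - #|S|)) *: red S P X.

Definition Tp1 r P (i : 'I_n) (X : op) : op :=
  avgp r P [set i] X - avgp r P set0 X.
Definition Tp2 r P (i j : 'I_n) (X : op) : op :=
  avgp r P [set i; j] X - avgp r P [set i] X - avgp r P [set j] X
  + avgp r P set0 X.

(* X acts (nontrivially) only on the sites of S: X = Y_S (x) Id *)
Definition acts_on (S : {set 'I_n}) (X : op) : Prop :=
  (forall s t : cfg, (exists2 k, k \notin S & s k != t k) -> ent X s t = 0) /\
  (forall s t s' t' : cfg,
     (forall k, k \in S -> s k = s' k /\ t k = t' k) ->
     (forall k, k \notin S -> s k = t k /\ s' k = t' k) ->
     ent X s t = ent X s' t').

Definition two_local (H : op) : Prop :=
  exists terms : seq ({set 'I_n} * op),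
    (forall x, x \in terms -> (#|x.1| <= 2)%N /\ acts_on x.1 x.2) /\
    H = \sum_(x <- terms) x.2.

Definition lind (m : 'I_n -> nat) (L : forall i, 'I_(m i) -> 'M[C]_d)
  (H : op) (X : op) : op :=
  - 'i *: comm H X + \sum_i \sum_(a < m i) diss (emb1 i (L i a)) X.

Definition Heff (m : 'I_n -> nat) (L : forall i, 'I_(m i) -> 'M[C]_d)
  (H : op) : op :=
  H - ('i / 2%:R) *: \sum_i \sum_(a < m i)
        (adjmx (emb1 i (L i a)) *m emb1 i (L i a)).

End QDefs.

(* Main.v *)
Require Import Defs.
From HB Require Import structures.
From mathcomp Require Import all_boot all_order all_algebra ring.
Import Order.TTheory GRing.Theory Num.Theory.
Local Open Scope ring_scope.
Set Implicit Arguments. Unset Strict Implicit. Unset Printing Implicit Defensive.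

(** Write Q = 1 - Pi.  The block Q L(rho^n) Q is a sum of positive operators
    (Q L_a sqrt(rho^n)) (Q L_a sqrt(rho^n))^*, so it vanishes iff every Lindblad
    operator preserves the image; the block Q L(rho^n) Pi then reduces to
    -i Q Heff rho^n, and the block Pi L(rho^n) Pi is the compressed Lindbladian
    at rho^n.

    On the image, let R be the pseudo-inverse of rho and K = Pi H Pi.  After right
    multiplication by R^n, stationarity reads
      -i (K - rho^n K R^n) + sum_i (w_i R)_i = 0,
    where w_i is the dissipative part at site i.  Conjugation by rho^n commutes
    with normalized partial traces, so applying T'_ij isolates condition (iv),
    and applying T'_i gives condition (iii) up to a multiple of rho; since the
    local generator is traceless and tr rho = 1, that multiple is zero.
    Conversely, a two-local K is its scalar part plus the sum of all T'_i K and
    T'_ij K, and (iii), (iv) make the contributions vanish separately.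

    Linear identities between operators are checked on product operators. *)

(** * Adjoints and the block decomposition *)

Section Adjoint.
Variable C : numClosedFieldType.

Lemma adjmxM (p q s : nat) (A : 'M[C]_(p, q)) (B : 'M[C]_(q, s)) :
  adjmx (A *m B) = adjmx B *m adjmx A.
Proof. by rewrite /adjmx map_mxM trmx_mul. Qed.

Lemma adjmxK (p q : nat) (A : 'M[C]_(p, q)) : adjmx (adjmx A) = A.
Proof. by apply/matrixP => i j; rewrite !mxE conjCK. Qed.

Lemma adjmxB (p q : nat) (A B : 'M[C]_(p, q)) :
  adjmx (A - B) = adjmx A - adjmx B.
Proof. by apply/matrixP => i j; rewrite !mxE rmorphB. Qed.

Lemma adjmxZ (p q : nat) (c : C) (A : 'M[C]_(p, q)) :
  adjmx (c *: A) = c^* *: adjmx A.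
Proof. by apply/matrixP => i j; rewrite !mxE rmorphM. Qed.

Lemma adjmx_sum (I : finType) (p q : nat) (A : I -> 'M[C]_(p, q)) :
  adjmx (\sum_a A a) = \sum_a adjmx (A a).
Proof.
apply/matrixP => i j; rewrite !mxE !summxE rmorph_sum /=.
by apply: eq_bigr => a _; rewrite !mxE.
Qed.

Lemma adjmx_diag (p : nat) (v : 'I_p -> C) :
  (forall k, v k \is Num.real) -> adjmx (diag_mx (\row_k v k)) = diag_mx (\row_k v k).
Proof.
move=> vR; apply/matrixP => i j; rewrite !mxE eq_sym.
by case: eqP => [->|_]; rewrite ?mulr1n ?mulr0n ?rmorph0 ?conj_Creal ?vR.
Qed.

Lemma adjmx1 (p : nat) : adjmx (1%:M : 'M[C]_p) = 1%:M.
Proof. by rewrite /adjmx map_mx1 trmx1. Qed.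

Lemma mxtrace_mul_adj_ge0 (p q : nat) (A : 'M[C]_(p, q)) : 0 <= \tr (A *m adjmx A).
Proof.
apply: sumr_ge0 => i _; rewrite mxE; apply: sumr_ge0 => j _.
by rewrite !mxE mul_conjC_ge0.
Qed.

Lemma mxtrace_mul_adj_eq0 (p q : nat) (A : 'M[C]_(p, q)) :
  \tr (A *m adjmx A) = 0 -> A = 0.
Proof.
have Aii_ge0 i : 0 <= (A *m adjmx A) i i.
  by rewrite mxE; apply: sumr_ge0 => j _; rewrite !mxE mul_conjC_ge0.
move=> /psumr_eq0P trA0; apply/matrixP => i j; rewrite mxE.
have /psumr_eq0P/(_ j isT) : \sum_j A i j * adjmx A j i = 0.
  by have := trA0 (fun i _ => Aii_ge0 i) i isT; rewrite mxE.
rewrite !mxE => Aij0; apply/eqP; rewrite -mul_conjC_eq0 Aij0 // => k _.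
by rewrite !mxE mul_conjC_ge0.
Qed.

(** Taking traces turns the positive summands into nonnegative numbers with sum zero. This separates
    the individual Lindblad operators. *)
Lemma sum_mul_adj_eq0 (I : finType) (p q : nat) (A : I -> 'M[C]_(p, q)) :
  \sum_a A a *m adjmx (A a) = 0 -> forall a, A a = 0.
Proof.
move=> /(congr1 mxtrace); rewrite raddf_sum /= mxtrace0 => /psumr_eq0P tr0 a.
by apply: mxtrace_mul_adj_eq0; apply: tr0 => // b _; apply: mxtrace_mul_adj_ge0.
Qed.

Lemma commDl (p : nat) (A B X : 'M[C]_p) : comm (A + B) X = comm A X + comm B X.
Proof. by rewrite /comm mulmxDl mulmxDr opprD addrACA. Qed.

Lemma commBl (p : nat) (A B X : 'M[C]_p) : comm (A - B) X = comm A X - comm B X.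
Proof. by rewrite /comm mulmxBl mulmxBr !opprD !opprK addrACA. Qed.

Lemma comm_suml (p : nat) (I : finType) (Q : pred I) (A : I -> 'M[C]_p) X :
  comm (\sum_(i | Q i) A i) X = \sum_(i | Q i) comm (A i) X.
Proof. by rewrite /comm mulmx_suml mulmx_sumr -sumrB. Qed.

Lemma mxtrace_comm (p : nat) (A B : 'M[C]_p) : \tr (comm A B) = 0.
Proof. by rewrite /comm raddfB /= mxtrace_mulC subrr. Qed.

Lemma mxtrace_diss (p : nat) (A X : 'M[C]_p) : \tr (diss A X) = 0.
Proof.
have trl : \tr (A *m X *m adjmx A) = \tr (adjmx A *m A *m X).
  by rewrite mxtrace_mulC mulmxA.
have trr : \tr (X *m (adjmx A *m A)) = \tr (adjmx A *m A *m X).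
  exact: mxtrace_mulC.
rewrite /diss raddfB /= mxtraceZ mxtraceD trl trr.
by field.
Qed.

(** The hypotheses make [P] act as identity on the image of [A] and [B] a right inverse of [A] on
    the range of [P], so invariance of the image becomes an equation with [P]. *)
Lemma maps_image_intoP (p : nat) (X A B P : 'M[C]_p) :
  A *m B = P -> P *m A = A ->
  reflect (P *m X *m P = X *m P) (maps_image_into X A).
Proof.
move=> AB PA; apply: (iffP submxP) => [[D /(congr1 trmx)]|XP].
  rewrite !trmx_mul !trmxK => XA.
  by rewrite -{2 3}AB !mulmxA -(mulmxA P) XA mulmxA PA.
(* Transposed, the goal asks for [W] with [X *m A = A *m W]; since [A *m B = P], the choice
   [W = B *m X *m A] works. *)
exists (B *m X *m A)^T; rewrite -!trmx_mul; congr (_^T).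
by rewrite !mulmxA AB -{1}PA mulmxA -XP -!mulmxA PA.
Qed.

End Adjoint.

Section Block.
Variables (C : numClosedFieldType) (N : nat) (I : finType).
Variables (H rho P R S : 'M[C]_N) (L : I -> 'M[C]_N).
Hypotheses (adjH : adjmx H = H) (adjP : adjmx P = P).
Hypotheses (Prho : P *m rho = rho) (rhoP : rho *m P = rho).
Hypotheses (rhoR : rho *m R = P) (rhoS : rho = S *m adjmx S).

Let heff := H - ('i / 2%:R) *: \sum_a (adjmx (L a) *m L a).

(** The anticommutators go into the anti-Hermitian part of [heff], which leaves only the jump terms
    [L a *m rho *m adjmx (L a)]. *)
Let lindE : - 'i *: comm H rho + \sum_a diss (L a) rho =
  - 'i *: (heff *m rho) + 'i *: (rho *m adjmx heff)
  + \sum_a L a *m rho *m adjmx (L a).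
Proof.
have adjheff : adjmx heff = H + ('i / 2%:R) *: \sum_a (adjmx (L a) *m L a).
  rewrite adjmxB adjmxZ adjH adjmx_sum fmorph_div /= conjCi rmorph_nat.
  rewrite mulNr scaleNr opprK; congr (_ + _ *: _).
  by apply: eq_bigr => a _; rewrite adjmxM adjmxK.
rewrite adjheff /heff /comm /diss.
rewrite [\sum_a _](big_split _ _ _ _) /= sumrN -scaler_sumr big_split /=.
rewrite -mulmx_suml -mulmx_sumr mulmxBl mulmxDr -scalemxAl -scalemxAr.
set a := H *m _; set b := _ *m H; set c := _ *m rho; set e := rho *m _.
set s := \sum_i _; apply/matrixP => x y; rewrite !mxE.
have ii : 'i * 'i = -1 :> C by rewrite -expr2 sqrCi.
ring: ii.
Qed.

(** Invariance of the range of [P] is what makes [adjmx (L a) *m L a] compress to the product of the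
    compressed factors. *)
Let compressed_lindE :
  (forall a, P *m L a *m P = L a *m P) ->
  - 'i *: comm (P *m H *m P) rho + \sum_a diss (P *m L a *m P) rho =
  P *m (- 'i *: comm H rho + \sum_a diss (L a) rho) *m P.
Proof.
move=> LP; rewrite mulmxDr mulmxDl -scalemxAr -scalemxAl; congr (_ *: _ + _).
  rewrite /comm mulmxBr mulmxBl; congr (_ - _).
    by rewrite -!mulmxA Prho rhoP.
  by rewrite !mulmxA rhoP Prho.
rewrite mulmx_sumr mulmx_suml; apply: eq_bigr => a _.
have adjLP : adjmx (P *m L a *m P) = P *m adjmx (L a) *m P.
  by rewrite !adjmxM adjP mulmxA.
have LL : P *m adjmx (L a) *m P *m (P *m L a *m P) = P *m (adjmx (L a) *m L a) *m P.
  rewrite -adjLP LP adjmxM adjP -!mulmxA; congr (_ *m _).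
rewrite /diss adjLP LL mulmxBr mulmxBl -scalemxAr -scalemxAl mulmxDr mulmxDl.
congr (_ - _ *: (_ + _)).
- rewrite -!mulmxA; do 2 congr (_ *m _).
  by rewrite !mulmxA Prho rhoP.
- by rewrite -!mulmxA Prho rhoP.
- by rewrite !mulmxA rhoP Prho.
Qed.

(** Here [R] turns equations against [rho] into equations against [P], and [S] exhibits each jump
    term as a positive operator. *)
Lemma stationary_blockP :
  - 'i *: comm H rho + \sum_a diss (L a) rho = 0 <->
  [/\ forall a, P *m L a *m P = L a *m P,
      P *m (H - ('i / 2%:R) *: \sum_a (adjmx (L a) *m L a)) *m P =
        (H - ('i / 2%:R) *: \sum_a (adjmx (L a) *m L a)) *m P
    & - 'i *: comm (P *m H *m P) rho + \sum_a diss (P *m L a *m P) rho = 0].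
Proof.
rewrite -/heff; move: (heff) lindE => h lindhE.
have [Q [QE Qrho rhoQ adjQ]] : exists Q : 'M[C]_N,
    [/\ forall X : 'M[C]_N, Q *m X = X - P *m X, Q *m rho = 0,
        rho *m Q = 0 & adjmx Q = Q].
  exists (1%:M - P); split=> [X||| ]; rewrite ?mulmxBl ?mulmxBr ?mul1mx ?mulmx1 //.
  - by rewrite Prho subrr.
  - by rewrite rhoP subrr.
  - by rewrite adjmxB adjmx1 adjP.
have invP X : Q *m X *m rho = 0 -> P *m X *m P = X *m P.
  move=> Xrho; have /eqP : Q *m X *m P = 0.
    by have := congr1 (mulmx^~ R) Xrho; rewrite -mulmxA rhoR mul0mx.
  by rewrite -mulmxA QE mulmxA subr_eq0 eq_sym => /eqP.
split=> [lind0|[LP hP]]; last first.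
  (* Converse: by invariance every term of the generator at [rho] is fixed by [P] on both sides, so
     it equals its compression, which vanishes. *)
  rewrite compressed_lindE // lindhE; set Y := _ + _; suff -> : P *m Y *m P = Y by [].
  have hrho : P *m h *m rho = h *m rho.
    by rewrite -{1}Prho !mulmxA hP -mulmxA Prho.
  have adjhP : rho *m adjmx h *m P = rho *m adjmx h.
    have := congr1 (@adjmx C N N) hP; rewrite !adjmxM adjP => adjhP.
    by rewrite -rhoP -!mulmxA adjhP.
  rewrite /Y !(mulmxDr, mulmxDl) -!(scalemxAr, scalemxAl).
  rewrite !mulmxA hrho Prho adjhP -!mulmxA rhoP; congr (_ + _).
  rewrite mulmx_suml mulmx_sumr; apply: eq_bigr => a _.
  have adjLP : P *m adjmx (L a) *m P = P *m adjmx (L a).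
    by have := congr1 (@adjmx C N N) (LP a); rewrite !adjmxM adjP mulmxA.
  rewrite -rhoP -!mulmxA (mulmxA P _ P) adjLP.
  by rewrite -Prho !mulmxA LP.
have LP a : P *m L a *m P = L a *m P.
  apply: invP.
  (* In the block cut out by [Q] on both sides only jump terms survive, and each is [Q *m L a *m S]
     times its adjoint. *)
  suff LS0 : forall a, Q *m L a *m S = 0 by rewrite rhoS mulmxA LS0 mul0mx.
  apply: sum_mul_adj_eq0.
  have /(congr1 (fun X => Q *m X *m Q)) := lind0.
  rewrite lindhE mulmx0 mul0mx => QYQ; rewrite -[RHS]QYQ.
  rewrite !(mulmxDr, mulmxDl) -!(scalemxAr, scalemxAl).
  rewrite !mulmxA Qrho -!(mulmxA _ rho) rhoQ !mulmx0 !mul0mx !scaler0 !add0r.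
  rewrite mulmx_sumr mulmx_suml; apply: eq_bigr => b _.
  by rewrite !adjmxM adjQ rhoS !mulmxA.
split=> //; last by rewrite compressed_lindE // lind0 mulmx0 mul0mx.
apply: invP; apply/eqP.
(* On the left, [Q] kills the term starting with [rho], and by [LP] also the jump terms; only the
   [heff] term remains. *)
have /(congr1 (mulmx Q)) := lind0.
rewrite lindhE mulmx0 !mulmxDr -!scalemxAr !mulmxA Qrho mul0mx scaler0 addr0.
rewrite mulmx_sumr big1 ?addr0 => [/eqP|a _].
  by rewrite scaler_eq0 oppr_eq0 (negPf (neq0Ci _)).
rewrite !mulmxA (_ : _ *m rho = 0) ?mul0mx //.
by rewrite -mulmxA QE -{1 2}Prho !mulmxA LP subrr.
Qed.

End Block.

(** * Product operators and partial traces *)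

Section Product.
Variables (C : numClosedFieldType) (n d : nat).
Local Notation op := (op C n d).
Local Notation cfg := (cfg n d).
Local Notation sites := ('I_n -> 'M[C]_d).
Implicit Types (f g : sites) (X Y : op) (S : {set 'I_n}).

Lemma ent_mkop (F : cfg -> cfg -> C) s t : ent (mkop F) s t = F s t.
Proof. by rewrite /ent mxE !enum_rankK. Qed.

Lemma opP X Y : (forall s t, ent X s t = ent Y s t) -> X = Y.
Proof.
move=> eqXY; apply/matrixP => a b.
by have := eqXY (enum_val a) (enum_val b); rewrite /ent !enum_valK.
Qed.

Lemma ent_embloc f s t : ent (embloc f) s t = \prod_k f k (s k) (t k).
Proof. exact: ent_mkop. Qed.

Lemma eq_embloc f g : f =1 g -> embloc f = embloc g.
Proof.
by move=> fg; apply: opP => s t; rewrite !ent_embloc; apply: eq_bigr => k _; rewrite fg.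
Qed.

Lemma sum_dimH (F : 'I_(dimH n d) -> C) : \sum_a F a = \sum_(s : cfg) F (enum_rank s).
Proof. by rewrite (reindex enum_rank) //; apply: onW_bij; apply: enum_rank_bij. Qed.

Lemma emblocM f g : embloc f *m embloc g = embloc (fun k => f k *m g k).
Proof.
apply: opP => s t; rewrite ent_embloc /ent mxE sum_dimH.
under [RHS]eq_bigr do rewrite mxE.
rewrite bigA_distr_bigA; apply: eq_bigr => u _.
by rewrite -!/(ent _ _ _) !ent_embloc big_split.
Qed.

Lemma adjmx_embloc f : adjmx (embloc f) = embloc (fun k => adjmx (f k)).
Proof.
apply: opP => s t; rewrite ent_embloc /ent !mxE rmorph_prod !enum_rankK.
by apply: eq_bigr => k _; rewrite !mxE.
Qed.

Lemma mxtrace_embloc f : \tr (embloc f) = \prod_k \tr (f k).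
Proof.
rewrite /mxtrace sum_dimH bigA_distr_bigA; apply: eq_bigr => s _.
by rewrite -/(ent _ _ _) ent_embloc.
Qed.

Lemma delta_embloc a b :
  delta_mx a b = embloc (fun k => delta_mx (enum_val a k) (enum_val b k)) :> op.
Proof.
apply: opP => s t; rewrite ent_embloc /ent mxE.
case: eqP => [<-|sa]; last first.
  have [k /eqP sk|eqs] := pickP (fun k => s k != enum_val a k).
    by rewrite (bigD1 k) //= mxE (introF eqP sk) mul0r.
  case: sa; rewrite -[a]enum_valK; congr enum_rank; apply/ffunP => k.
  by have /negbFE/eqP := eqs k.
case: eqP => [<-|tb] /=.
  by rewrite big1 // => k _; rewrite !enum_rankK mxE !eqxx.
have [k /eqP tk|eqt] := pickP (fun k => t k != enum_val b k).
  by rewrite (bigD1 k) //= mxE (introF eqP tk) andbF mul0r.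
case: tb; rewrite -[b]enum_valK; congr enum_rank; apply/ffunP => k.
by have /negbFE/eqP := eqt k.
Qed.

(** Matrix units are product operators by [delta_embloc], so product operators span. *)
Lemma op_linear_ext (V : lmodType C) (F G : op -> V) :
  linear F -> linear G -> (forall f, F (embloc f) = G (embloc f)) -> F =1 G.
Proof.
move=> linF linG FG X.
have F0 : F 0 = 0 by have := linF (-1) 0 0; rewrite scaler0 add0r scaleN1r addNr.
have G0 : G 0 = 0 by have := linG (-1) 0 0; rewrite scaler0 add0r scaleN1r addNr.
rewrite (matrix_sum_delta X); elim/big_rec: _ => [|a Y _ IH]; first by rewrite F0.
elim/big_rec: _ => [|b Z _ IHb]; first by rewrite !add0r.
by rewrite -addrA linF linG IHb delta_embloc FG.
Qed.

Lemma ent_linear s t (c : C) X Y :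
  ent (c *: X + Y) s t = c * ent X s t + ent Y s t.
Proof. by rewrite /ent !mxE. Qed.

(** The background [Z] is a parameter because three are in use: [1%:M] for Lindblad operators, [P]
    for operators on the image, [rho] for terms of the generator at the product state. *)
Definition loc (i : 'I_n) (Z X : 'M[C]_d) : op :=
  embloc (fun k => if k == i then X else Z).

Lemma ent_loc i (Z X : 'M[C]_d) s t :
  ent (loc i Z X) s t = X (s i) (t i) * \prod_(k | k != i) Z (s k) (t k).
Proof.
rewrite ent_embloc (bigD1 i) //= eqxx; congr (_ * _).
by apply: eq_bigr => k /negPf->.
Qed.

Lemma loc_linear i Z : linear (loc i Z).
Proof.
by move=> c X Y; apply: opP => s t; rewrite ent_linear !ent_loc !mxE mulrDl mulrA.
Qed.

HB.instance Definition _ i Z :=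
  GRing.isLinear.Build C 'M[C]_d op _ (loc i Z) (loc_linear i Z).

Lemma locM i (Z W X Y : 'M[C]_d) : loc i Z X *m loc i W Y = loc i (Z *m W) (X *m Y).
Proof. by rewrite emblocM; apply: eq_embloc => k; case: ifP. Qed.

Lemma loc_const i Z : loc i Z Z = embloc (fun=> Z).
Proof. by apply: eq_embloc => k; case: ifP. Qed.

Lemma adjmx_loc i (Z X : 'M[C]_d) : adjmx (loc i Z X) = loc i (adjmx Z) (adjmx X).
Proof. by rewrite adjmx_embloc; apply: eq_embloc => k; case: ifP. Qed.

Lemma mxtrace_loc i (Z X : 'M[C]_d) : \tr (loc i Z X) = \tr X * \tr Z ^+ n.-1.
Proof.
rewrite mxtrace_embloc (bigD1 i) //= eqxx; congr (_ * _).
rewrite (eq_bigr (fun=> \tr Z)) => [|k /negPf-> //].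
by rewrite prodr_const cardC1 card_ord.
Qed.

(** A nonzero entry of [Z], chosen at every site but [i], puts a nonzero factor in front of any
    given entry at site [i]. *)
Lemma loc_inj i Z : Z != 0 -> injective (loc i Z).
Proof.
move=> Z0 X Y /(congr1 (fun W => W - loc i Z Y)); rewrite -raddfB subrr /= => XY0.
apply/eqP; rewrite -subr_eq0; apply/eqP/matrixP => a b; rewrite [RHS]mxE.
have [[a0 b0] /= Zab|Z00] := pickP (fun ab => Z ab.1 ab.2 != 0); last first.
  case/eqP: Z0; apply/matrixP => x y; rewrite mxE.
  by have /negbFE/eqP := Z00 (x, y).
have := congr1 (fun W : op => ent W [ffun k => if k == i then a else a0]
  [ffun k => if k == i then b else b0]) XY0.
rewrite ent_loc !ffunE eqxx /ent [in RHS]mxE => /eqP.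
rewrite mulf_eq0 => /orP[/eqP //|].
rewrite prodf_seq_eq0 => /hasP[k _ /andP[/negPf ki]].
by rewrite !ffunE ki (negPf Zab).
Qed.

Lemma avgp_linear r P S : linear (avgp r P S : op -> op).
Proof.
move=> c X Y; rewrite /avgp scalerA mulrC -scalerA -scalerDr; congr (_ *: _).
apply: opP => s t; rewrite ent_linear /red !ent_mkop mulrCA -mulrDr; congr (_ * _).
by rewrite mulr_sumr -big_split; apply: eq_bigr => p _; rewrite ent_linear.
Qed.

HB.instance Definition _ r P S :=
  GRing.isLinear.Build C op op _ (avgp r P S) (avgp_linear r P S).

Definition avgloc (r : nat) (P X : 'M[C]_d) : 'M[C]_d := (\tr X / r%:R) *: P.

Lemma card_setC_ord S : #|~: S| = (n - #|S|)%N.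
Proof. by rewrite cardsCs setCK card_ord. Qed.

(** The partial trace of a product factorizes over sites, and the normalization gives one factor
    [r%:R^-1] to each site off [S]. *)
Lemma avgp_embloc r P S f : avgp r P S (embloc f) =
  embloc (fun k => if k \in S then f k else avgloc r P (f k)).
Proof.
apply: opP => s t; rewrite ent_embloc.
rewrite (_ : ent _ s t = r%:R ^- (n - #|S|) * ent (red S P (embloc f)) s t);
  last by rewrite /ent mxE.
rewrite ent_mkop.
have -> : \sum_(p : cfg | [forall k in S, p k == s k]) ent (embloc f) p (glue S t p) =
    \prod_k (if k \in S then f k (s k) (t k) else \tr (f k)).
  (* The constraint that [p] agrees with [s] on [S] becomes a Kronecker delta at each site of [S],
     so the sum over configurations distributes into local sums. *)
  transitivity (\prod_k \sum_j (if k \in S then (j == s k)%:R * f k j (t k) else f k j j)).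
    rewrite bigA_distr_bigA big_mkcond /=; apply: eq_bigr => p _; case: ifP.
      move=> /forall_inP ps; rewrite ent_embloc; apply: eq_bigr => k _.
      by rewrite ffunE; case: ifP => // kS; rewrite ps // mul1r.
    move=> /negbT; rewrite negb_forall_in => /exists_inP[k kS /negPf pk].
    by rewrite (bigD1 k) //= kS pk !mul0r.
  apply: eq_bigr => k _; case: ifP => // _.
  by rewrite (bigD1 (s k)) //= eqxx mul1r big1 ?addr0 // => j /negPf->; rewrite mul0r.
rewrite [X in _ * (_ * X)](bigID (mem S)) [RHS](bigID (mem S)) /=.
have -> : r%:R ^- (n - #|S|) = \prod_(k | k \notin S) (r%:R^-1 : C).
  rewrite (eq_bigl (mem (~: S))) ?prodr_const => [|k]; last by rewrite /= inE.
  by rewrite exprVn card_setC_ord.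
have mulACE (a p q u : C) : a * (p * (q * u)) = q * (a * p * u) by ring.
rewrite mulACE -!big_split /=; congr (_ * _).
  by apply: eq_bigr => k ->.
by apply: eq_bigr => k /negPf->; rewrite mxE; ring.
Qed.

(** The [d ^ (n - #|S|)] configurations agreeing with [s] on [S] all contribute the same entry,
    which cancels the normalization. *)
Lemma acts_on_avgp S X : (0 < d)%N -> acts_on S X -> avgp d 1%:M S X = X.
Proof.
move=> d0 [Xdiag Xinv]; apply: opP => s t.
rewrite (_ : ent _ s t = d%:R ^- (n - #|S|) * ent (red S 1%:M X) s t);
  last by rewrite /ent mxE.
rewrite ent_mkop.
have [k /andP[kS skt]|st] := pickP (fun k => (k \notin S) && (s k != t k)).
  rewrite Xdiag; last by exists k.
  by rewrite (bigD1 k) //= mxE (negPf skt) !mul0r mulr0.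
have {}st k : k \notin S -> s k = t k.
  by move=> kS; have := st k; rewrite kS => /negbFE/eqP.
rewrite big1 ?mul1r => [|k kS]; last by rewrite mxE st // eqxx.
rewrite (eq_bigr (fun=> ent X s t)) => [|p /forall_inP ps]; last first.
  apply: Xinv => k kS; rewrite ffunE; first by rewrite kS (eqP (ps k kS)).
  by rewrite (negPf kS) st.
rewrite sumr_const -[X in _ * X]mulr_natl mulrA.
suff -> : #|[pred p : cfg | [forall k in S, p k == s k]]| = (d ^ (n - #|S|))%N.
  by rewrite natrX mulVf ?mul1r // expf_neq0 // pnatr_eq0 -lt0n.
rewrite (eq_card (B := family (fun k => if k \in S then pred1 (s k) else predT))).
  rewrite card_family foldrE big_map big_enum (bigID (mem S)) /= big1 => [|k ->]; last by rewrite card1.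
  rewrite mul1n (eq_bigr (fun=> d)) => [|k /negPf->]; last by rewrite card_ord.
  rewrite (eq_bigl (mem (~: S))) ?prod_nat_const => [|k]; last by rewrite /= inE.
  by rewrite card_setC_ord.
move=> p; rewrite !inE; apply/forall_inP/familyP => ps k.
  by case: ifP => // kS; rewrite inE ps.
by move=> kS; have := ps k; rewrite kS.
Qed.

End Product.

(** * Compression to the image *)

Section Compression.
Variables (C : numClosedFieldType) (n d r : nat) (P rho R : 'M[C]_d).
Hypotheses (adjP : adjmx P = P) (PP : P *m P = P).
Hypotheses (Prho : P *m rho = rho) (rhoP : rho *m P = rho).
Hypotheses (PR : P *m R = R) (RP : R *m P = R).
Hypotheses (rhoR : rho *m R = P) (Rrho : R *m rho = P).
Hypotheses (trP : \tr P = r%:R) (r_neq0 : r%:R != 0 :> C) (tr_rho : \tr rho = 1).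

Local Notation op := (op C n d).
Local Notation Pi := (embloc (fun _ : 'I_n => P)).
Local Notation rhon := (embloc (fun _ : 'I_n => rho)).
Local Notation Rn := (embloc (fun _ : 'I_n => R)).
Local Notation avg := (avgp r P).
Local Notation avg1 := (avgloc r P).
Implicit Types (X : op) (S : {set 'I_n}) (f : 'I_n -> 'M[C]_d).

Definition compress X : op := Pi *m X *m Pi.

Lemma compress_linear : linear compress.
Proof. by move=> c X Y; rewrite /compress mulmxDr mulmxDl -scalemxAr -scalemxAl. Qed.

HB.instance Definition _ :=
  GRing.isLinear.Build C op op _ compress compress_linear.

Lemma compress_embloc f : compress (embloc f) = embloc (fun k => P *m f k *m P).
Proof. by rewrite /compress !emblocM. Qed.

Lemma Tp1_linear i : linear (Tp1 r P i : op -> op).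
Proof.
move=> c X Y; rewrite /Tp1 !avgp_linear; apply/matrixP => a b.
by move: (avg _ _) (avg _ _) (avg _ _) (avg _ _) => *; rewrite !mxE; ring.
Qed.

HB.instance Definition _ i :=
  GRing.isLinear.Build C op op _ (Tp1 r P i) (Tp1_linear i).

Lemma Tp2_linear i j : linear (Tp2 r P i j : op -> op).
Proof.
move=> c X Y; rewrite /Tp2 !avgp_linear; apply/matrixP => a b.
move: (avg _ _) (avg _ _) (avg _ _) (avg _ _) => *.
by move: (avg _ _) (avg _ _) (avg _ _) (avg _ _) => *; rewrite !mxE; ring.
Qed.

HB.instance Definition _ i j :=
  GRing.isLinear.Build C op op _ (Tp2 r P i j) (Tp2_linear i j).

Lemma avg1P (c : C) : avg1 (c *: P) = c *: P.
Proof. by rewrite /avgloc mxtraceZ trP mulfK. Qed.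

Lemma Tp1_eq0 i f : avg1 (f i) = f i -> Tp1 r P i (embloc f) = 0.
Proof.
move=> fi; rewrite /Tp1 !avgp_embloc; apply/eqP; rewrite subr_eq0; apply/eqP.
by apply: eq_embloc => k; rewrite !inE; case: eqP => // ->.
Qed.

(** A factor that is already a multiple of [P] is unchanged by averaging, so the four averages
    cancel in pairs. *)
Lemma Tp2_eq0 i j f :
  avg1 (f i) = f i \/ avg1 (f j) = f j -> Tp2 r P i j (embloc f) = 0.
Proof.
rewrite /Tp2 !avgp_embloc => -[fi|fj].
  rewrite (_ : embloc (fun k => if k \in [set i; j] then _ else _) =
    embloc (fun k => if k \in [set j] then f k else avg1 (f k))); last first.
    by apply: eq_embloc => k; rewrite !inE; case: eqP => //= ->; case: ifP.
  rewrite (_ : embloc (fun k => if k \in [set i] then _ else _) =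
    embloc (fun k => if k \in set0 then f k else avg1 (f k))); last first.
    by apply: eq_embloc => k; rewrite !inE; case: eqP => //= ->.
  by rewrite [X in X + _]addrAC subrr sub0r addNr.
rewrite (_ : embloc (fun k => if k \in [set i; j] then _ else _) =
  embloc (fun k => if k \in [set i] then f k else avg1 (f k))); last first.
  by apply: eq_embloc => k; rewrite !inE; case: eqP => //= _; case: eqP => // ->.
rewrite (_ : embloc (fun k => if k \in [set j] then _ else _) =
  embloc (fun k => if k \in set0 then f k else avg1 (f k))); last first.
  by apply: eq_embloc => k; rewrite !inE; case: eqP => //= ->.
by rewrite subrr sub0r addNr.
Qed.

Lemma Tp1_loc (i : 'I_n) (X : 'M[C]_d) : Tp1 r P i (loc i P X) = loc i P (X - avg1 X).
Proof.
have avgP : avg1 P = P by have := avg1P 1; rewrite !scale1r.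
rewrite /Tp1 !avgp_embloc raddfB /=; congr (_ - _); apply: eq_embloc => k.
  by rewrite !inE; case: (k == i).
by rewrite !inE; case: (k == i).
Qed.

(** On [S] the local factors are untouched. Off [S], cyclicity and [R *m rho = P] preserve the trace
    of a compressed factor, and conjugation fixes [P]. *)
Lemma avg_conj S X :
  avg S (rhon *m compress X *m Rn) = rhon *m avg S (compress X) *m Rn.
Proof.
move: X; apply: op_linear_ext => [c X Y|c X Y|f].
- by rewrite !(compress_linear, avgp_linear, mulmxDl, mulmxDr) -!(scalemxAl, scalemxAr) avgp_linear.
- by rewrite !(compress_linear, avgp_linear, mulmxDl, mulmxDr) -!(scalemxAl, scalemxAr).
rewrite !(compress_embloc, emblocM, avgp_embloc); apply: eq_embloc => k.
case: ifP => // _; rewrite /avgloc -scalemxAr -scalemxAl rhoP rhoR.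
by rewrite [\tr (_ *m R)]mxtrace_mulC !mulmxA Rrho PP.
Qed.

Lemma avg_compressM S X : avg S (compress X) *m Pi = avg S (compress X).
Proof.
move: X; apply: op_linear_ext => [c X Y|c X Y|f].
- by rewrite !(compress_linear, avgp_linear, mulmxDl) -!scalemxAl.
- by rewrite !(avgp_linear, compress_linear).
rewrite !(compress_embloc, emblocM, avgp_embloc); apply: eq_embloc => k.
by case: ifP => _; rewrite /avgloc -?scalemxAl -?mulmxA PP.
Qed.

(** Off [S'] the averaged factor is a multiple of [P], which commutes with [P] and [Z]; on [S'] the
    other operator carries [P], the unit of the image. *)
Lemma avg_compress_comm (S S' : {set 'I_n}) (Z : 'M[C]_d) X :
  S' \subset S -> P *m Z = Z -> Z *m P = Z ->
  comm (avg S' (compress X)) (embloc (fun k => if k \in S then P else Z)) = 0.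
Proof.
move=> /subsetP sS PZ ZP; apply/eqP; rewrite subr_eq0; apply/eqP.
move: X; apply: op_linear_ext => [c X Y|c X Y|f].
- by rewrite !(compress_linear, avgp_linear, mulmxDl) -!scalemxAl.
- by rewrite !(compress_linear, avgp_linear, mulmxDr) -!scalemxAr.
rewrite !(compress_embloc, emblocM, avgp_embloc); apply: eq_embloc => k.
have [/sS->|_] := boolP (k \in S'); first by rewrite !mulmxA PP -mulmxA PP.
by case: ifP => _; rewrite /avgloc -scalemxAl -scalemxAr ?PZ ?ZP ?PP.
Qed.

(* T lives on the image and is of the form T_S (x) P off S; only these two
   consequences are needed. *)
Definition commuting_part S (T : op) :=
  T *m Pi = T /\
  forall Z, P *m Z = Z -> Z *m P = Z ->
    comm T (embloc (fun k => if k \in S then P else Z)) = 0.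

Lemma commuting_partB S T T' :
  commuting_part S T -> commuting_part S T' -> commuting_part S (T - T').
Proof.
move=> [TP cT] [TP' cT']; split=> [|Z PZ ZP]; first by rewrite mulmxBl TP TP'.
by rewrite commBl cT // cT' // subr0.
Qed.

Lemma commuting_part_avg S S' X :
  S' \subset S -> commuting_part S (avg S' (compress X)).
Proof.
by move=> sS; split=> [|Z PZ ZP]; [exact: avg_compressM|exact: avg_compress_comm].
Qed.

Lemma commuting_part_Tp1 i X : commuting_part [set i] (Tp1 r P i (compress X)).
Proof. by apply: commuting_partB; apply: commuting_part_avg; rewrite ?sub0set. Qed.

Lemma commuting_part_Tp2 i j X :
  commuting_part [set i; j] (Tp2 r P i j (compress X)).
Proof.
have sub1 k : k \in [set i; j] -> [set k] \subset [set i; j] by rewrite sub1set.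
have -> (Y : op) : Tp2 r P i j Y =
    (avg [set i; j] Y - avg [set i] Y) - (avg [set j] Y - avg set0 Y).
  by rewrite opprB addrA addrAC.
by apply: commuting_partB; apply: commuting_partB; apply: commuting_part_avg;
  rewrite ?sub0set ?sub1 ?inE ?eqxx ?orbT.
Qed.

Lemma Tp1_conj i X :
  Tp1 r P i (rhon *m compress X *m Rn) = rhon *m Tp1 r P i (compress X) *m Rn.
Proof. by rewrite /Tp1 !avg_conj mulmxBr mulmxBl. Qed.

Lemma Tp2_conj i j X :
  Tp2 r P i j (rhon *m compress X *m Rn) = rhon *m Tp2 r P i j (compress X) *m Rn.
Proof. by rewrite /Tp2 !avg_conj !(mulmxDr, mulmxDl, mulmxN, mulNmx). Qed.

Local Notation rhoS S := (embloc (fun k : 'I_n => if k \in S then rho else P)).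

(** Multiplying by [R] off [S], which commutes with [T], turns the extra factors [rho] into [P].
    With [comm_rhon], this lets condition (iv) be tested against the full product state. *)
Lemma comm_rhoS S T : commuting_part S T ->
  comm T (rhoS S) = comm T rhon *m embloc (fun k => if k \in S then P else R).
Proof.
move=> [_ /(_ _ PR RP) /eqP]; rewrite subr_eq0 => /eqP cT.
have rhoSE : rhon *m embloc (fun k => if k \in S then P else R) = rhoS S.
  by rewrite emblocM; apply: eq_embloc => k; case: ifP.
by rewrite /comm mulmxBl -!mulmxA cT rhoSE (mulmxA rhon) rhoSE.
Qed.

Lemma comm_rhon S T : commuting_part S T ->
  comm T rhon = comm T (rhoS S) *m embloc (fun k => if k \in S then P else rho).
Proof.
move=> [_ /(_ _ Prho rhoP) /eqP]; rewrite subr_eq0 => /eqP cT.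
have rhonE : rhoS S *m embloc (fun k => if k \in S then P else rho) = rhon.
  by rewrite emblocM; apply: eq_embloc => k; case: ifP.
by rewrite /comm mulmxBl -!mulmxA cT rhonE (mulmxA (rhoS S)) rhonE.
Qed.

(** The components of order at most two in the cluster expansion of [X]: scalar, one-site and
    two-site. *)
Definition truncate X : op :=
  avg set0 X + \sum_i Tp1 r P i X + \sum_(i < n) \sum_(j < n | (i < j)%N) Tp2 r P i j X.

Lemma truncate_linear : linear truncate.
Proof.
move=> c X Y; rewrite /truncate avgp_linear.
have -> : \sum_i Tp1 r P i (c *: X + Y) =
    c *: \sum_i Tp1 r P i X + \sum_i Tp1 r P i Y.
  by rewrite scaler_sumr -big_split; apply: eq_bigr => i _; exact: Tp1_linear.
have -> : \sum_(i < n) \sum_(j < n | (i < j)%N) Tp2 r P i j (c *: X + Y) =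
    c *: \sum_(i < n) \sum_(j < n | (i < j)%N) Tp2 r P i j X +
    \sum_(i < n) \sum_(j < n | (i < j)%N) Tp2 r P i j Y.
  rewrite scaler_sumr -big_split; apply: eq_bigr => i _.
  by rewrite scaler_sumr -big_split; apply: eq_bigr => j _; exact: Tp2_linear.
by rewrite (addrACA (c *: avg set0 X)) (addrACA (c *: avg set0 X + _)) -!scalerDr.
Qed.

(** Components involving a site off [S] vanish; the others telescope by inclusion-exclusion to
    [avg S], which fixes the operator. *)
Lemma truncate_embloc S f : (#|S| <= 2)%N ->
  (forall k, k \notin S -> avg1 (f k) = f k) -> truncate (embloc f) = embloc f.
Proof.
move=> cS fS; rewrite /truncate.
have avgS : avg S (embloc f) = embloc f.
  rewrite avgp_embloc; apply: eq_embloc => k.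
  by case: ifP => // kS; apply: fS; rewrite kS.
have T1 i : i \notin S -> Tp1 r P i (embloc f) = 0.
  by move=> iS; apply: Tp1_eq0; apply: fS.
have T2 i j : (i \notin S) || (j \notin S) -> Tp2 r P i j (embloc f) = 0.
  by move=> /orP[] kS; apply: Tp2_eq0; [left|right]; apply: fS.
have [S0|[a Sa]|[a [b [ab Sab]]]] : [\/ S = set0, exists a, S = [set a]
    | exists a b, a != b /\ S = [set a; b]].
  move: cS; rewrite leq_eqVlt ltnS leq_eqVlt ltnS leqn0.
  case/or3P=> [/cards2P|/cards1P|]; [by constructor 3|by constructor 2|].
  by rewrite cards_eq0 => /eqP; constructor 1.
- rewrite !big1 ?addr0 ?S0 // => [|i _|i _]; first by rewrite -S0.
    by rewrite big1 // => j _; rewrite T2 // S0 inE.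
  by rewrite T1 // S0 inE.
- rewrite (bigD1 a) //= big1 => [|i ia]; last by rewrite T1 // Sa inE.
  rewrite big1 => [|i _]; last first.
    rewrite big1 // => j ij; rewrite T2 // -negb_and Sa !inE.
    by apply/andP => -[/eqP ia /eqP ja]; rewrite ia ja ltnn in ij.
  by rewrite !addr0 /Tp1 addrC subrK -Sa avgS.
(* Each pair occurs only once in the double sum, in increasing order. *)
wlog lt_ab : a b ab Sab / (a < b)%N => [IH|].
  have [lt_ab|lt_ba|/val_inj eq_ab] := ltngtP a b; first exact: IH Sab lt_ab.
    by apply: (IH b a); rewrite 1?eq_sym // setUC.
  by rewrite eq_ab eqxx in ab.
have -> : \sum_i Tp1 r P i (embloc f) = Tp1 r P a (embloc f) + Tp1 r P b (embloc f).
  rewrite (bigD1 a) //= (bigD1 b) /= 1?eq_sym // big1 ?addr0 // => i /andP[ia ib].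
  by rewrite T1 // Sab !inE negb_or ia.
have -> : \sum_(i < n) \sum_(j < n | (i < j)%N) Tp2 r P i j (embloc f) =
    Tp2 r P a b (embloc f).
  rewrite (bigD1 a) //= [X in _ + X]big1 => [|i ia]; last first.
    rewrite big1 // => j ij; rewrite T2 // -negb_and Sab !inE (negPf ia) /=.
    apply/andP=> -[/eqP ib /orP[]/eqP ja]; rewrite ib ja in ij; last by rewrite ltnn in ij.
    by rewrite ltnNge ltnW in ij.
  rewrite (bigD1 b) //= big1 ?addr0 // => j /andP[aj jb].
  have ja : j != a by apply: contraTneq aj => ->; rewrite ltnn.
  by rewrite T2 // Sab !inE (negPf ja) (negPf jb) orbT.
rewrite /Tp1 /Tp2 -Sab avgS; apply/matrixP => x y.
by move: (embloc _) (avg _ _) (avg _ _) (avg _ _) => *; rewrite !mxE; ring.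
Qed.

Lemma truncate_compress X : (0 < d)%N -> two_local X ->
  truncate (compress X) = compress X.
Proof.
move=> d0 [terms [loc_terms ->]].
have tr0 : truncate 0 = 0.
  by have := truncate_linear (-1) 0 0; rewrite scaler0 add0r scaleN1r addNr.
elim: terms loc_terms => [|[S Y] terms IH] loc_terms.
  by rewrite big_nil raddf0 tr0.
rewrite big_cons raddfD /=.
have := truncate_linear 1 (compress Y) (compress (\sum_(x <- terms) x.2)).
rewrite !scale1r => ->; rewrite IH => [|x x_in]; last by apply: loc_terms; rewrite inE x_in orbT.
congr (_ + _); have [/= cS Yact] := loc_terms (S, Y) (mem_head _ _).
(* Once [Y] is written as its own average, both sides are linear in an arbitrary operator, and
   product operators suffice. *)
rewrite -(acts_on_avgp d0 Yact).
move: (Y); apply: op_linear_ext => [c Z W|c Z W|f].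
- by rewrite !(avgp_linear, compress_linear) truncate_linear.
- by rewrite !(avgp_linear, compress_linear).
rewrite avgp_embloc compress_embloc; apply: (truncate_embloc cS) => k /negPf->.
by rewrite /avgloc -!scalemxAr -!scalemxAl mulmx1 PP -/(avg1 _) avg1P.
Qed.

(** Since [P] fixes [Z] on both sides, all terms of the dissipator share the background [Z]. *)
Lemma diss_loc (i : 'I_n) (Z X Y : 'M[C]_d) : P *m Z = Z -> Z *m P = Z ->
  diss (loc i P X) (loc i Z Y) = loc i Z (diss X Y).
Proof.
move=> PZ ZP; rewrite /diss adjmx_loc adjP !locM PP PZ ZP.
by rewrite -raddfD -linearZ -raddfB.
Qed.

Lemma diss_compress (X : 'M[C]_d) (Y := P *m X *m P) :
  P *m diss Y rho = diss Y rho /\ diss Y rho *m P = diss Y rho.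
Proof.
have PY : P *m Y = Y by rewrite /Y !mulmxA PP.
have YP : Y *m P = Y by rewrite /Y -mulmxA PP.
clearbody Y.
have PY' : P *m adjmx Y = adjmx Y by rewrite -{1}adjP -adjmxM YP.
have YP' : adjmx Y *m P = adjmx Y by rewrite -{1}adjP -adjmxM PY.
rewrite /diss; split.
  by rewrite mulmxBr -scalemxAr mulmxDr !mulmxA PY PY' Prho.
by rewrite mulmxBl -scalemxAl mulmxDl -!mulmxA YP' YP rhoP.
Qed.

Lemma compressed_stationaryP X (w : 'I_n -> 'M[C]_d) :
  (0 < d)%N -> two_local X ->
  (forall i, P *m w i = w i) -> (forall i, w i *m P = w i) ->
  (forall i, \tr (w i) = 0) ->
  - 'i *: comm (compress X) rhon + \sum_i loc i rho (w i) = 0 <->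
  (forall i, - 'i *: comm (Tp1 r P i (compress X)) (loc i P rho) + loc i P (w i) = 0)
  /\ (forall i j : 'I_n, (i < j)%N ->
        comm (Tp2 r P i j (compress X)) (rhoS [set i; j]) = 0).
Proof.
move=> d0 locX Pw wP trw; set K := compress X.
have loc_rhoS i : loc i P rho = rhoS [set i].
  by apply: eq_embloc => k; rewrite inE.
have cPart1 i := commuting_part_Tp1 i X; have cPart2 i j := commuting_part_Tp2 i j X.
rewrite -/K in cPart1 cPart2.
split=> [Y0|[T1 T2]].
  have KPi : K *m Pi = K.
    by rewrite /K /compress -!mulmxA emblocM; do 2 congr (_ *m _); apply: eq_embloc.
  (* Right multiplication by [Rn] changes the background of the dissipative terms from [rho] to [P],
     so each is trivial at all sites but its own. *)
  have YR : - 'i *: (K - rhon *m K *m Rn) + \sum_i loc i P (w i *m R) = 0.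
    have := congr1 (mulmx^~ Rn) Y0.
    rewrite mul0mx mulmxDl -scalemxAl mulmx_suml mulmxBl -(mulmxA K) emblocM.
    rewrite (eq_embloc (g := fun=> P)) // KPi => YR; rewrite -[RHS]YR.
    congr (_ + _); apply: eq_bigr => i _.
    by rewrite -(loc_const i R) locM rhoR.
  split=> [i|i j lt_ij].
    have := congr1 (Tp1 r P i) YR.
    rewrite Tp1_linear (raddf0 (Tp1 r P i)) (raddfB (Tp1 r P i)) (raddf_sum (Tp1 r P i)) /=.
    rewrite (bigD1 i) //= [X in _ + (_ + X)]big1 => [|k ki]; last first.
      apply: Tp1_eq0; rewrite eq_sym (negPf ki).
      by have := avg1P 1; rewrite !scale1r.
    rewrite addr0 Tp1_loc Tp1_conj -/K; set T := Tp1 r P i K.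
    (* Multiplying by [rho] at site [i] undoes the factor [R] there. *)
    move=> /(congr1 (mulmx^~ (loc i P rho))).
    rewrite mul0mx mulmxDl -scalemxAl mulmxBl locM PP.
    rewrite (mulmxBl (w i *m R)) -(mulmxA (w i)) Rrho wP.
    have -> : rhon *m T *m Rn *m loc i P rho = loc i P rho *m T.
      have [_ /(_ _ PR RP)/eqP] := cPart1 i; rewrite subr_eq0 => /eqP cT.
      have RE : Rn *m loc i P rho = embloc (fun k => if k \in [set i] then P else R).
        by rewrite emblocM; apply: eq_embloc => k; rewrite inE; case: ifP.
      have rhoE : rhon *m embloc (fun k => if k \in [set i] then P else R) = loc i P rho.
        by rewrite emblocM; apply: eq_embloc => k; rewrite inE; case: ifP.
      by rewrite -mulmxA RE -mulmxA cT mulmxA rhoE.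
    have locB c : loc i P (w i - c *: rho) = loc i P (w i) - c *: loc i P rho.
      by rewrite addrC -scaleNr loc_linear scaleNr addrC.
    rewrite -/(comm _ _) /avgloc -scalemxAl Prho locB addrA.
    (* The subtracted average leaves a term [c *: loc i P rho]. The other terms are traceless, while
       [loc i P rho] has the nonzero trace [r%:R ^+ n.-1], so [c] is zero. *)
    set c := _ / _ => /eqP; rewrite subr_eq0 => /eqP E; rewrite E.
    suff /eqP -> : c == 0 by rewrite scale0r.
    have := congr1 mxtrace E.
    rewrite mxtraceD !mxtraceZ mxtrace_comm mulr0 add0r !mxtrace_loc trw mul0r.
    rewrite tr_rho mul1r trP => /esym/eqP; rewrite mulf_eq0 expf_eq0 (negPf r_neq0).
    by rewrite andbF orbF.
  have := congr1 (Tp2 r P i j) YR; rewrite Tp2_linear.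
  rewrite (raddf0 (Tp2 r P i j)) (raddfB (Tp2 r P i j)) (raddf_sum (Tp2 r P i j)) /=.
  (* No site [k] is both [i] and [j], so each dissipative term carries [P] at one of them. *)
  rewrite big1 => [|k _]; last first.
    apply: Tp2_eq0; have avgP : avg1 P = P by have := avg1P 1; rewrite !scale1r.
    have [ik|] := eqVneq i k; last by left.
    by right; case: eqP => // jk; rewrite jk ik ltnn in lt_ij.
  rewrite addr0 Tp2_conj -/K; set T := Tp2 r P i j K.
  move=> /eqP; rewrite scaler_eq0 oppr_eq0 (negPf (neq0Ci _)) subr_eq0 /= => /eqP TE.
  rewrite (comm_rhoS (cPart2 i j)) -/T.
  (* [TE] says that [T] is fixed by conjugation with [rhon] and [Rn]; multiplying by [rhon] gives
     commutation. *)
  suff -> : comm T rhon = 0 by rewrite mul0mx.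
  have Rrhon : Rn *m rhon = Pi by rewrite emblocM; apply: eq_embloc.
  have Trhon : T *m rhon = rhon *m T.
    by rewrite {1}TE -[LHS]mulmxA Rrhon -[LHS]mulmxA (cPart2 i j).1.
  by rewrite /comm Trhon subrr.
(* Two-locality splits the commutator into components. The scalar one commutes with [rhon], and the
   pair ones vanish by [T2]. *)
have -> : comm K rhon = comm (truncate K) rhon by rewrite /K truncate_compress.
rewrite /truncate !commDl.
have -> : comm (avg set0 K) rhon = 0.
  have [_ /(_ _ Prho rhoP)] := commuting_part_avg X (sub0set set0).
  by rewrite (eq_embloc (g := fun=> rho)) // => k; rewrite inE.
rewrite add0r !comm_suml [X in _ *: (_ + X)]big1 => [|i _]; last first.
  rewrite comm_suml big1 // => j ij.
  by rewrite (comm_rhon (cPart2 i j)) T2 // mul0mx.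
rewrite addr0 scaler_sumr -big_split big1 //= => i _.
(* The commutator and the dissipative term at [i] share the right factor with [P] at [i] and [rho]
   elsewhere, so [T1] kills their sum. *)
rewrite (comm_rhon (cPart1 i)) -loc_rhoS scalemxAl.
rewrite (_ : loc i rho (w i) = loc i P (w i) *m
    embloc (fun k => if k \in [set i] then P else rho)).
  by rewrite -mulmxDl T1 mul0mx.
by rewrite emblocM; apply: eq_embloc => k; rewrite inE; case: ifP.
Qed.

End Compression.

(** * Spectral calculus *)

Section Spectral.
Variables (C : numClosedFieldType) (d : nat) (U : 'M[C]_d).
Hypothesis UU : adjmx U *m U = 1%:M.

(** Functional calculus in the eigenbasis: relations between [rho], its support projection,
    pseudo-inverse and square root become identities between eigenvalues. *)
Definition spec (v : 'I_d -> C) : 'M[C]_d := U *m diag_mx (\row_k v k) *m adjmx U.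

Lemma eq_spec v w : v =1 w -> spec v = spec w.
Proof.
by move=> vw; congr (_ *m diag_mx _ *m _); apply/rowP => k; rewrite !mxE vw.
Qed.

Lemma specM v w : spec v *m spec w = spec (fun k => v k * w k).
Proof.
rewrite /spec !mulmxA -(mulmxA _ (adjmx U)) UU mulmx1 -(mulmxA U) mulmx_diag.
by congr (_ *m diag_mx _ *m _); apply/rowP => k; rewrite !mxE.
Qed.

Lemma adjmx_spec v : (forall k, v k \is Num.real) -> adjmx (spec v) = spec v.
Proof. by move=> vR; rewrite /spec !adjmxM adjmxK adjmx_diag // mulmxA. Qed.

Lemma mxtrace_spec v : \tr (spec v) = \sum_k v k.
Proof.
rewrite /spec mxtrace_mulC mulmxA UU mul1mx mxtrace_diag.
by apply: eq_bigr => k _; rewrite mxE.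
Qed.

Lemma spec_proj (Q : pred 'I_d) :
  \sum_(k | Q k) col k U *m adjmx (col k U) = spec (fun k => (Q k)%:R).
Proof.
apply/matrixP => a b; rewrite summxE !mxE big_mkcond; apply: eq_bigr => k _.
rewrite mul_mx_diag !mxE big_ord1 !mxE.
by case: (Q k); rewrite ?mulr1 // mulr0 mul0r.
Qed.

Lemma quadratic_spec v k : (adjmx (col k U) *m spec v *m col k U) 0 0 = v k.
Proof.
have Uk : adjmx U *m col k U = delta_mx k 0 by rewrite colE mulmxA UU mul1mx.
have kU : adjmx (col k U) *m U = delta_mx 0 k.
  apply/matrixP => i j; rewrite -[U in _ *m U]adjmxK -adjmxM Uk !mxE.
  by rewrite rmorph_nat andbC ord1.
rewrite /spec !mulmxA kU -(mulmxA _ (adjmx U)) Uk -rowE -colE !mxE eqxx mulr1n.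
by [].
Qed.

End Spectral.

(** * Assembly of the block and compressed criteria into the four conditions *)

Theorem theorem1 (C : numClosedFieldType) (n d : nat)
  (m : 'I_n -> nat) (L : forall i : 'I_n, 'I_(m i) -> 'M[C]_d)
  (H : op C n d)
  (rho U : 'M[C]_d) (lam : 'I_d -> C) (r : nat) :
  adjmx H = H ->
  two_local H ->
  density rho ->
  (* spectral decomposition rho = sum_k lam_k |psi_k><psi_k|, psi_k = col k U *)
  adjmx U *m U = 1%:M ->
  rho = U *m diag_mx (\row_k lam k) *m adjmx U ->
  (r <= d)%N ->
  (forall k : 'I_d, (k < r)%N -> lam k != 0) ->
  (forall k : 'I_d, (r <= k)%N -> lam k = 0) ->
  let P : 'M[C]_d := \sum_(k : 'I_d | (k < r)%N) col k U *m adjmx (col k U) in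
  let Pi : op C n d := embloc (fun _ => P) in
  let rhon : op C n d := embloc (fun _ => rho) in
  let PHP := Pi *m H *m Pi in
  lind L H rhon = 0 <->
  [/\ (* (i) *)
      forall (i : 'I_n) (a : 'I_(m i)), maps_image_into (L i a) rho,
      (* (ii) *)
      maps_image_into (Heff L H) rhon,
      (* (iii) PL_i(rho_loc) = 0, as operators on Im(rho)^{(x) n} *)
      forall i : 'I_n,
        - 'i *: comm (Tp1 r P i PHP) (embloc (fun k => if k == i then rho else P))
        + \sum_(a < m i)
            diss (Pi *m emb1 i (L i a) *m Pi)
                 (embloc (fun k => if k == i then rho else P)) = 0
    & (* (iv) *)
      forall i j : 'I_n, (i < j)%N ->
        comm (Tp2 r P i j PHP)
             (embloc (fun k => if (k == i) || (k == j) then rho else P)) = 0].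
Proof.
move=> adjH locH [_ tr_rho rho_ge0] UU rhoE le_rd lam_neq0 lam_eq0 P Pi rhon PHP.
rewrite -/(spec U lam) in rhoE.
(* The pseudo-inverse, as 0^-1 = 0. *)
pose R := spec U (fun k => (lam k)^-1).
pose S := spec U (fun k => sqrtC (lam k)).
have lam_ge0 k : 0 <= lam k.
  by have := rho_ge0 (col k U); rewrite rhoE quadratic_spec.
have PE : P = spec U (fun k : 'I_d => (k < r)%N%:R) by apply: spec_proj.
have lamP (k : 'I_d) : (k < r)%N%:R * lam k = lam k.
  by case: ltnP => [_|/lam_eq0->]; rewrite ?mul1r ?mulr0.
have lamV (k : 'I_d) : lam k * (lam k)^-1 = (k < r)%N%:R.
  by case: ltnP => [/lam_neq0/divff|/lam_eq0->] //; rewrite mul0r.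
have lamVP (k : 'I_d) : (k < r)%N%:R * (lam k)^-1 = (lam k)^-1.
  by case: ltnP => [_|/lam_eq0->]; rewrite ?mul1r ?invr0 ?mulr0.
have adjP : adjmx P = P by rewrite PE adjmx_spec // => k; apply: realn.
have PP : P *m P = P.
  by rewrite PE specM //; apply: eq_spec => k; case: (k < r)%N; rewrite ?mulr1 ?mulr0.
have Prho : P *m rho = rho by rewrite PE rhoE specM //; apply: eq_spec.
have rhoP : rho *m P = rho.
  by rewrite PE rhoE specM //; apply: eq_spec => k; rewrite mulrC.
have PR : P *m R = R by rewrite PE specM //; apply: eq_spec.
have RP : R *m P = R by rewrite PE specM //; apply: eq_spec => k; rewrite mulrC.
have rhoR : rho *m R = P by rewrite PE rhoE specM //; apply: eq_spec.
have Rrho : R *m rho = P.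
  by rewrite PE rhoE specM //; apply: eq_spec => k; rewrite mulrC.
have rhoS : rho = S *m adjmx S.
  rewrite adjmx_spec => [|k]; last by rewrite ger0_real ?sqrtC_ge0.
  by rewrite rhoE specM //; apply: eq_spec => k; rewrite -expr2 sqrtCK.
have trP : \tr P = r%:R.
  rewrite PE mxtrace_spec // (eq_bigr _ (fun k _ => mulrb 1 _)) -big_mkcond /=.
  by rewrite -(big_ord_widen _ (fun=> 1)) // sumr_const card_ord.
(* Trace one rules out rank zero, which makes the normalization by powers of [r] legitimate and
   forces [d] to be positive. *)
have rho_neq0 : rho != 0.
  by apply/eqP => rho0; move/eqP: tr_rho; rewrite rho0 mxtrace0 eq_sym oner_eq0.
have P_neq0 : P != 0.
  by apply: contraNneq rho_neq0 => P0; rewrite -Prho P0 mul0mx.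
have r_neq0 : r%:R != 0 :> C.
  apply: contraNneq P_neq0 => /eqP; rewrite pnatr_eq0 => /eqP r0.
  rewrite PE (@eq_spec _ _ U _ (fun=> 0)) => [|k]; last by rewrite r0.
  rewrite /spec (_ : \row_k 0 = 0) ?raddf0 ?mulmx0 ?mul0mx //.
  by apply/rowP => k; rewrite !mxE.
have d_gt0 : (0 < d)%N.
  by apply: leq_trans le_rd; rewrite lt0n; apply: contraNneq r_neq0 => ->.
pose Rn : op C n d := embloc (fun=> R).
have Pirhon : Pi *m rhon = rhon by rewrite emblocM; apply: eq_embloc.
have rhonPi : rhon *m Pi = rhon by rewrite emblocM; apply: eq_embloc.
have rhonRn : rhon *m Rn = Pi by rewrite emblocM; apply: eq_embloc.
have adjPi : adjmx Pi = Pi by rewrite adjmx_embloc; apply: eq_embloc.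
have rhonS : rhon = embloc (fun=> S) *m adjmx (embloc (fun=> S)).
  by rewrite adjmx_embloc emblocM; apply: eq_embloc.
have PiE i : Pi = loc i P P by rewrite loc_const.
have emb1Pi i X : emb1 i X *m Pi = loc i P (X *m P).
  by rewrite (PiE i) -[emb1 i X]/(loc i 1%:M X) locM mul1mx.
have Piemb1Pi i X : Pi *m emb1 i X *m Pi = loc i P (P *m X *m P).
  by rewrite -mulmxA emb1Pi (PiE i) locM PP mulmxA.
pose w i := \sum_(a < m i) diss (P *m L i a *m P) rho.
have w_loc i Z : P *m Z = Z -> Z *m P = Z ->
    \sum_(a < m i) diss (Pi *m emb1 i (L i a) *m Pi) (loc i Z rho) = loc i Z (w i).
  move=> PZ ZP; rewrite raddf_sum; apply: eq_bigr => a _.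
  by rewrite Piemb1Pi (diss_loc adjP PP).
have Pw i : P *m w i = w i.
  by rewrite mulmx_sumr; apply: eq_bigr => a _; apply: (diss_compress adjP PP Prho rhoP (L i a)).1.
have wP i : w i *m P = w i.
  by rewrite mulmx_suml; apply: eq_bigr => a _; apply: (diss_compress adjP PP Prho rhoP (L i a)).2.
have trw i : \tr (w i) = 0.
  by rewrite raddf_sum big1 // => a _; apply: mxtrace_diss.
(* Pairs of a site and a label form one finite index type, as the block criterion expects. *)
pose Ls (p : {i : 'I_n & 'I_(m i)}) := emb1 (tag p) (L (tag p) (tagged p)).
have lindE : lind L H rhon = - 'i *: comm H rhon + \sum_p diss (Ls p) rhon.
  by rewrite /lind sig_big_dep.
have HeffE : Heff L H = H - ('i / 2%:R) *: \sum_p (adjmx (Ls p) *m Ls p).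
  by rewrite /Heff sig_big_dep.
have sum_wE : \sum_p diss (Pi *m Ls p *m Pi) rhon = \sum_i loc i rho (w i).
  transitivity (\sum_i \sum_(a < m i) diss (Pi *m emb1 i (L i a) *m Pi) rhon).
    by rewrite sig_big_dep.
  by apply: eq_bigr => i _; rewrite -w_loc // loc_const.
have := compressed_stationaryP PP Prho rhoP PR RP rhoR Rrho trP r_neq0 tr_rho
  d_gt0 locH Pw wP trw.
rewrite -[compress P H]/PHP -/rhon => stationaryE.
rewrite lindE (stationary_blockP Ls adjH adjPi Pirhon rhonPi rhonRn rhonS).
rewrite -HeffE sum_wE.
split=> [[LP HP /stationaryE[T1 T2]]|[LP HP T1 T2]]; split.
- move=> i a; apply/(maps_image_intoP _ rhoR Prho).
  (* Both sides have background [P], which is nonzero, so the equation descends to site [i]. *)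
  apply: (loc_inj (i := i) P_neq0); rewrite -Piemb1Pi -emb1Pi.
  exact: LP (Tagged (fun i => 'I_(m i)) a).
- by apply/(maps_image_intoP _ rhonRn Pirhon).
- by move=> i; rewrite -/(loc i P rho) w_loc.
- move=> i j lt_ij; rewrite -[RHS](T2 i j lt_ij); congr (comm _ _).
  by apply: eq_embloc => k; rewrite !inE.
- move=> [i a]; rewrite /Ls /= Piemb1Pi emb1Pi; congr (loc _ _ _).
  exact/(maps_image_intoP _ rhoR Prho)/LP.
- exact/(maps_image_intoP _ rhonRn Pirhon).
apply/stationaryE; split=> [i|i j lt_ij]; first by rewrite -w_loc // T1.
rewrite -[RHS](T2 i j lt_ij); congr (comm _ _).
by apply: eq_embloc => k; rewrite !inE.
Qed.
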